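(* Let $m,n$ be positive integers with $n$ odd. Then no symmetric Cauchy tensor of order $m$ and dimension $n$ is skew centrosymmetric.
   Context: Write $[n]=\{1,\dots,n\}$. Given $c=(c_1,\dots,c_n)\in\mathbb{R}^n$ with $c_{i_1}+\cdots+c_{i_m}\ne0$ for all $i_1,\dots,i_m\in[n]$, the (symmetric) Cauchy tensor of order $m$ and dimension $n$ with generating vector $c$ is the real tensor $\mathcal{C}=(c_{i_1\cdots i_m})$ with entries $c_{i_1i_2\cdots i_m}=\dfrac{1}{c_{i_1}+c_{i_2}+\cdots+c_{i_m}}$. A tensor $(a_{i_1\cdots i_m})$ of order $m$ and dimension $n$ is skew centrosymmetric if $a_{i_1\cdots i_m}=-a_{n-i_1+1,\dots,n-i_m+1}$ for all indices in $[n]$. *)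

(* Defs.v *)
From mathcomp Require Import all_boot all_order all_algebra.
From mathcomp Require Import reals.

Set Implicit Arguments.
Unset Strict Implicit.
Unset Printing Implicit Defensive.

Import GRing.Theory.
Local Open Scope ring_scope.

(* The index set [n] = {1, ..., n} is represented by 'I_n = {0, ..., n-1}, and
   a multi-index (i_1, ..., i_m) by an m-tuple over 'I_n. *)
Definition tensor (R : Type) (m n : nat) := {ffun m.-tuple 'I_n -> R}.

Definition index_sum (R : realType) (m n : nat) (c : 'rV[R]_n)
    (i : m.-tuple 'I_n) : R :=
  \sum_(k < m) c ord0 (tnth i k).

Definition cauchy_tensor (R : realType) (m n : nat) (c : 'rV[R]_n) :
    tensor R m n :=
  [ffun i : m.-tuple 'I_n => 1 / index_sum c i].

(* The nonvanishing condition excludes the convention 1 / 0 = 0. *)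
Definition symmetric_cauchy_tensor (R : realType) (m n : nat)
    (A : tensor R m n) : Prop :=
  exists c : 'rV[R]_n,
    (forall i : m.-tuple 'I_n, index_sum c i != 0) /\ A = cauchy_tensor m c.

(* With indices starting at 0, i |-> n - i + 1 becomes i |-> n - 1 - i,
   which is rev_ord. *)
Definition skew_centrosymmetric (R : realType) (m n : nat)
    (A : tensor R m n) : Prop :=
  forall i : m.-tuple 'I_n, A i = - A (map_tuple (@rev_ord n) i).

(* Main.v *)
Require Import Defs.
From mathcomp Require Import all_boot all_order all_algebra.
From mathcomp Require Import reals.
From mathcomp Require Import zify.

Import GRing.Theory Num.Theory.

(** For odd $n$ the reversal of indices fixes the middle one, [n./2] when counting from 0
    ([rev_ord_half]). Skew centrosymmetry thus forces the diagonal entry there to be 0, whereas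
    every entry of a Cauchy tensor is the inverse of a nonzero sum. *)

Lemma rev_ord_half (n : nat) (lt_half : (n./2 < n)%N) :
  odd n -> rev_ord (Ordinal lt_half) = Ordinal lt_half.
Proof. by move=> n_odd; apply: val_inj => /=; lia. Qed.

Theorem mainTheorem15 (R : realType) (m n : nat)
    (m_gt0 : (0 < m)%N) (n_gt0 : (0 < n)%N) (n_odd : odd n)
    (A : tensor R m n) :
  symmetric_cauchy_tensor A -> ~ skew_centrosymmetric A.
Proof.
case=> c [c_neq0 ->] skewA.
have lt_half : (n./2 < n)%N by lia.
pose i := [tuple of nseq m (Ordinal lt_half)].
(* The constant multi-index at the middle is fixed by the reversal, so the
   entry there equals its own opposite. *)
have rev_i : map_tuple (@rev_ord n) i = i.
  by apply: val_inj; rewrite /= map_nseq rev_ord_half.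
have /eqP := skewA i.
(* Twice the entry is 0, so in characteristic 0 the entry is 0; an inverse vanishes only if the
   index sum does, against [c_neq0]. *)
rewrite rev_i -addr_eq0 -mulr2n mulrn_eq0 /= ffunE div1r invr_eq0.
exact/negP.
Qed.
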